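(* For every formula $\varphi$ of $\mathrm{S1S}+\mathsf{U}$ there effectively exists a formula $\varphi'$ of $\mathrm{S1S}+\forall^{=1}$ such that $L(\varphi)=L(\varphi')$.
   Context: $\mathrm{S1S}$ is monadic second-order logic over $(\omega,<)$: formulas are built from atoms $x<y$, $x\in X$ using $\neg$, $\vee$, first-order quantification $\forall x$ over $\omega$ and second-order quantification $\forall X$ over subsets of $\omega$; subsets of $\omega$ are identified with $\omega$-words in $\{0,1\}^\omega$, and a formula with free second-order variables $Y_1,\dots,Y_n$ defines the language $L(\varphi)\subseteq(\{0,1\}^n)^\omega$ of tuples satisfying it. $\mathrm{S1S}+\mathsf{U}$ adds the quantifier $\mathsf{U}X.\,\phi$: a tuple $w$ satisfies $\mathsf{U}X.\,\phi(X,Y_1,\dots,Y_n)$ iff for every $n\in\omega$ there is a finite set $w'\subseteq\omega$ with more than $n$ elements such that $(w',w)$ satisfies $\phi$. $\mathrm{S1S}+\forall^{=1}$ adds the quantifier $\forall^{=1}X.\,\phi$: a tuple $w$ satisfies $\forall^{=1}X.\,\phi(X,Y_1,\dots,Y_n)$ iff $\mu(\{w'\in\{0,1\}^\omega\mid (w',w)\text{ satisfies }\phi\})=1$, where $\mu$ is the uniform (fair coin-flipping) product probability measure on $\{0,1\}^\omega$. *)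

(* Defs.v *)
From HB Require Import structures.
From mathcomp Require Import all_boot all_order all_algebra.
From mathcomp Require Import finmap all_classical all_reals all_analysis.
From mathcomp Require Import zify lra.
From Stdlib Require Cantor.
Set Implicit Arguments.
Unset Strict Implicit.
Unset Printing Implicit Defensive.
Import Order.TTheory GRing.Theory Num.Theory.
Import numFieldNormedType.Exports.
Local Open Scope classical_set_scope.
Local Open Scope ring_scope.

(* Subsets of omega, identified with omega-words over {0,1}. *)
Definition word : Type := nat -> bool.
HB.instance Definition _ := Pointed.on word.

Definition cylinder (s : seq bool) : set word :=
  [set w | mkseq w (size s) = s].

(* Words with the product sigma-algebra, generated by the cylinders. *)
Notation coin_space := (g_sigma_algebraType (range cylinder)).

Definition digits (R : realType) (x : measurableTypeR R) : coin_space :=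
  fun n => odd (Num.truncn ((x : R) * 2 ^+ n.+1)).

Section digits.
Variable R : realType.
Local Notation digits := (@digits R).

Lemma measurable_digit n (b : bool) : measurable [set x : R | digits x n = b].
Proof.
have mt k : measurable [set x : R | (Num.truncn (x * 2 ^+ n.+1) <= k)%N].
  rewrite (_ : mkset _ = `]-oo, (k.+1%:R / 2 ^+ n.+1)[%classic); first exact: measurable_itv.
  apply/seteqP; split => x /=; rewrite in_itv/= truncn_le_nat ltr_pdivlMr ?exprn_gt0//.
have mE k : measurable [set x : R | Num.truncn (x * 2 ^+ n.+1) = k].
  case: k => [|k].
    rewrite (_ : mkset _ = [set x : R | (Num.truncn (x * 2 ^+ n.+1) <= 0)%N])//.
    by apply/seteqP; split => x /=; lia.
  rewrite (_ : mkset _ = [set x : R | (Num.truncn (x * 2 ^+ n.+1) <= k.+1)%N]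
    `\` [set x : R | (Num.truncn (x * 2 ^+ n.+1) <= k)%N]); first exact: measurableD.
  by apply/seteqP; split => x /=; lia.
rewrite (_ : mkset _ = \bigcup_(k in [set k | odd k = b])
   [set x : R | Num.truncn (x * 2 ^+ n.+1) = k]); last first.
  apply/seteqP; split => [x /= <-|x [k /= <- <-]]//.
  by exists (Num.truncn (x * 2 ^+ n.+1)).
exact: bigcup_measurable.
Qed.

Lemma measurable_digits : measurable_fun [set: measurableTypeR R] digits.
Proof.
refine (@measurability _ _ (measurableTypeR R) coin_space _ _ (range cylinder) erefl _).
move=> _ [_ [s _ <-] <-].
rewrite setTI (_ : _ @^-1` _ = \bigcap_(i in `I_(size s))
    [set x | digits x i = nth false s i]).
  by apply: bigcap_measurableType => i _; exact: measurable_digit.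
apply/seteqP; split => x /=.
  by rewrite /cylinder/= => xs i /= si; rewrite -xs nth_mkseq.
move=> xs; apply: (@eq_from_nth _ false); rewrite size_mkseq// => i si.
by rewrite nth_mkseq// (xs i).
Qed.

HB.instance Definition _ := isMeasurableFun.Build _ _ _ _ _ measurable_digits.

End digits.

(* The fair coin-flipping measure, realized as the law of the binary digits of a
   uniform point of [0, 1]; by coin_cylinder and coin_unique below it is the
   only probability measure giving mass 2^-n to each cylinder of length n. *)
Definition coin (R : realType) : probability coin_space R :=
  distribution (uniform_prob (@ltr01 R)) (@digits R).

Section coin_lemmas.
Variable R : realType.
Implicit Types (x : R) (s : seq bool).

Let val s := foldl (fun v (b : bool) => v.*2 + b)%N 0%N s.

Let val_rcons s b : val (rcons s b) = ((val s).*2 + b)%N.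
Proof. by rewrite /val foldl_rcons. Qed.

Let val_lt s : (val s < 2 ^ size s)%N.
Proof.
elim/last_ind: s => // s b ih.
by rewrite val_rcons size_rcons expnS; lia.
Qed.

Let val_inj s t : size s = size t -> val s = val t -> s = t.
Proof.
elim/last_ind: s t => [|s b ih] t; elim/last_ind: t => [|t c _]//;
  rewrite ?size_rcons// => -[st]; rewrite !val_rcons => e.
have -> : b = c by case: b c e => -[]; lia.
by rewrite (ih t st)//; case: b c e => -[]; lia.
Qed.

Let val_digits x n : 0 <= x < 1 ->
  val (mkseq (digits x) n) = Num.truncn (x * 2 ^+ n).
Proof.
move=> /andP[x0 x1]; elim: n => [|n ih].
  by apply/esym/eqP; rewrite mulr1 truncn_eq// x0.
rewrite mkseqS val_rcons ih /digits.
have y0 : 0 <= x * 2 ^+ n by rewrite mulr_ge0// exprn_ge0.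
rewrite exprSr mulrA; move: (x * 2 ^+ n) y0 => y y0.
rewrite -[RHS]odd_double_half addnC; congr (_ + _.*2)%N.
apply/eqP; rewrite truncn_eq//.
have /andP[] := truncn_itv (mulr_ge0 y0 (ler0n R 2)).
rewrite -{1 2}(odd_double_half (Num.truncn (y * 2))) -muln2.
move: (Num.truncn _)./2 (odd _) => k b.
rewrite -!natr1 natrD natrM; case: b => /= h1 h2; apply/andP; split; lra.
Qed.

Let unif_itv (a b : R) : 0 <= a -> a < b -> b <= 1 ->
  uniform_prob (@ltr01 R) `[a, b[ = (b - a)%:E.
Proof.
move=> a0 ab b1; rewrite /uniform_prob.
rewrite (eq_integral (cst 1%:E)); last first.
  move=> x; rewrite inE/= in_itv/= => /andP[ax xb].
  by rewrite /uniform_pdf (le_trans a0 ax) (le_trans (ltW xb) b1) subr0 invr1.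
by rewrite integral_cst//= mul1e lebesgue_measure_itv/= lte_fin ab.
Qed.

Lemma coin_cylinder s : coin R (cylinder s) = ((2 ^+ size s)^-1)%:E.
Proof.
pose P : probability (measurableTypeR R) R := uniform_prob (@ltr01 R); set n := size s; set v := val s.
change (P (@digits R @^-1` cylinder s) = ((2 ^+ n)^-1)%:E).
have n0 : 0 < 2 ^+ n :> R by rewrite exprn_gt0.
have mD : measurable (@digits R @^-1` cylinder s).
  rewrite -[X in measurable X]setTI; apply: measurable_digits => //.
  by apply: sub_sigma_algebra; exists s.
have DI : @digits R @^-1` cylinder s `&` `[0, 1[ =
    `[v%:R / 2 ^+ n, v.+1%:R / 2 ^+ n[%classic.
  apply/seteqP; split => x /=; rewrite !in_itv/=.
    move=> [xs x01]; have := val_digits n x01; rewrite xs => /esym/eqP.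
    have [x0 _] := andP x01.
    rewrite truncn_eq ?(mulr_ge0 x0 (ltW n0))//.
    by rewrite ler_pdivrMr// ltr_pdivlMr.
  rewrite ler_pdivrMr// ltr_pdivlMr// => xv.
  have x0 : 0 <= x by rewrite -(pmulr_lge0 _ n0) (le_trans _ (andP xv).1).
  have x1 : x < 1.
    rewrite -(ltr_pM2r n0) mul1r (lt_le_trans (andP xv).2)//.
    by rewrite -natrX ler_nat; exact: val_lt.
  have x01 : 0 <= x < 1 by rewrite x0.
  split=> //; apply: val_inj; first by rewrite size_mkseq.
  rewrite val_digits//; apply/eqP.
  by rewrite truncn_eq ?(mulr_ge0 x0 (ltW n0)).
have nv : v.+1%:R / 2 ^+ n <= 1 :> R.
  by rewrite ler_pdivrMr// mul1r -natrX ler_nat; exact: val_lt.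
have P0 : P (@digits R @^-1` cylinder s `\` `[0, 1[) = 0.
  apply/eqP; rewrite -measure_le0.
  rewrite (@le_trans _ _ (P (~` `[0, 1[)))//.
    by apply: le_measure; rewrite ?inE//; [exact: measurableD|exact: measurableC].
  have -> : P (~` `[0, 1[) = (1 - P `[0%R, 1%R[%classic)%E by exact: probability_setC.
  by rewrite /P/= unif_itv// subr0 subee.
rewrite -(setUIDK (@digits R @^-1` cylinder s) `[0, 1[).
rewrite measureU//; last 3 first.
- exact: measurableI.
- exact: measurableD.
- by apply/seteqP; split => // x [[_ xI] [_ /(_ xI)]].
rewrite [X in (_ + X)%E]P0 adde0 DI /P/= unif_itv//.
- by rewrite -mulrBl -natr1 addrAC subrr add0r mul1r.
all: by rewrite ?divr_ge0 ?ltr_pM2r ?invr_gt0 ?ltr_nat// ltW.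
Qed.

Lemma coin_unique (P : probability coin_space R) :
    (forall s, P (cylinder s) = ((2 ^+ size s)^-1)%:E) ->
  forall A, measurable A -> P A = coin R A.
Proof.
move=> Pc A mA.
have mc s : measurable (cylinder s : set coin_space).
  by apply: sub_sigma_algebra; exists s.
pose G : set (set coin_space) := [set set0] `|` range cylinder.
apply: (@g_sigma_algebra_measure_unique _ _ coin_space G _
  (fun=> cylinder [::]) _ _ P (coin R)) => //=.
- by move=> _ [->|[s _ <-]].
- by move=> _; right; exists [::].
- by rewrite bigcup_const//; apply/seteqP.
- move=> _ _ [->|[s _ <-]] [->|[t _ <-]]; rewrite ?set0I ?setI0; try by left.
  wlog st : s t / (size s <= size t)%N.
    by move=> h; case: (leqP (size s) (size t)) => [|/ltnW] /h//; rewrite setIC.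
  have take_mkseq (w : word) : take (size s) (mkseq w (size t)) = mkseq w (size s).
    by rewrite /mkseq -map_take take_iota (minn_idPl st).
  have [ts|ts] := eqVneq (take (size s) t) s; [right; exists t => //|left].
    apply/seteqP; split => w; rewrite /cylinder/=; last by case.
    by move=> tw; split => //; rewrite -take_mkseq tw.
  apply/seteqP; split => w //; rewrite /cylinder/= => -[sw tw].
  by move/eqP: ts; apply; rewrite -[in RHS]sw -take_mkseq tw.
- move=> _ [->|[s _ <-]]; first by rewrite !measure0.
  by rewrite [LHS]Pc; exact/esym/coin_cylinder.
- by move=> _; rewrite Pc ltry.
- by apply: sub_sigma_algebra2 mA; exact: subsetUr.
Qed.

(* "Almost everywhere" is membership in measure-one sets of the completion of
   coin; on sets of the product sigma-algebra it reads coin R A = 1. *)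
Lemma ae_coinE (A : set word) : measurable (A : set coin_space) ->
  (\forall w \ae coin R, A w) <-> coin R A = 1%E.
Proof.
move=> mA; have mC := measurableC mA.
apply: (iff_trans (negligibleP _ mC)).
have e : coin R (~` A) = (1 - coin R A)%E by exact: probability_setC.
rewrite [X in X = _ <-> _]e; split=> [/eqP|->]; last by rewrite subee.
by rewrite sube_eq ?fin_num_measure// ?add0e ?fin_num_adde_defl// => /eqP.
Qed.

End coin_lemmas.

Local Open Scope nat_scope.

(* Common syntax of S1S+U and S1S+forall^{=1}.  First-order and set variables
   are named by two separate copies of nat. *)
Inductive formula : Type :=
| Less of nat & nat               (* x < y *)
| Mem of nat & nat                (* x \in X *)
| Not of formula
| Or of formula & formula
| AllFO of nat & formula
| AllSO of nat & formula
| Unb of nat & formula            (* U X. phi *)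
| Almost of nat & formula.        (* forall^{=1} X. phi *)

Fixpoint in_S1S_U (phi : formula) : bool :=
  match phi with
  | Less _ _ | Mem _ _ => true
  | Not f | AllFO _ f | AllSO _ f | Unb _ f => in_S1S_U f
  | Or f g => in_S1S_U f && in_S1S_U g
  | Almost _ _ => false
  end.

Fixpoint in_S1S_Almost (phi : formula) : bool :=
  match phi with
  | Less _ _ | Mem _ _ => true
  | Not f | AllFO _ f | AllSO _ f | Almost _ f => in_S1S_Almost f
  | Or f g => in_S1S_Almost f && in_S1S_Almost g
  | Unb _ _ => false
  end.

Fixpoint free_fo (phi : formula) : seq nat :=
  match phi with
  | Less x y => [:: x; y]
  | Mem x _ => [:: x]
  | Or f g => free_fo f ++ free_fo g
  | AllFO x f => [seq y <- free_fo f | y != x]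
  | Not f | AllSO _ f | Unb _ f | Almost _ f => free_fo f
  end.

Fixpoint free_so (phi : formula) : seq nat :=
  match phi with
  | Less _ _ => [::]
  | Mem _ X => [:: X]
  | Or f g => free_so f ++ free_so g
  | AllSO X f | Unb X f | Almost X f => [seq Y <- free_so f | Y != X]
  | Not f | AllFO _ f => free_so f
  end.

(* A set that is not in the product sigma-algebra has measure one when it does
   in the completion of coin, whence the almost-everywhere quantifier. *)
Fixpoint sat (R : realType) (v : nat -> nat) (V : nat -> word)
    (phi : formula) : Prop :=
  match phi with
  | Less x y => v x < v y
  | Mem x X => V X (v x)
  | Not f => ~ sat R v V f
  | Or f g => sat R v V f \/ sat R v V g
  | AllFO x f => forall k : nat, sat R [eta v with x |-> k] V f
  | AllSO X f => forall W : word, sat R v [eta V with X |-> W] f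
  | Unb X f => forall n : nat, exists2 A : {fset nat},
      n < #|` A|%fset & sat R v [eta V with X |-> fun k => k \in A] f
  | Almost X f =>
      \forall W \ae coin R, sat R v [eta V with X |-> (W : word)] f
  end.

(* The i-th component of the letters of w is the value of the i-th variable of
   Y.  The values given to the other variables are immaterial when the free
   variables of phi are all listed in Y. *)
Definition language (R : realType) (n : nat) (Y : n.-tuple nat)
    (phi : formula) : set (nat -> n.-tuple bool) :=
  [set w | sat R (fun=> 0) (fun X k => nth false (w k) (index X Y)) phi].

(* Partial recursive functions in their unary presentation: several arguments
   are passed as one number through the Cantor pairing.  computes p a b means
   that p converges on a with value b; Rec p q is primitive recursion and
   Min p minimization, both on the second component of the argument. *)
Definition cpair (a b : nat) : nat := Cantor.to_nat (a, b).
Arguments cpair : simpl never.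
Notation "<| a , b |>" := (cpair a b)
  (at level 0, a at level 99, b at level 99).

Inductive prog : Type :=
| Zero | Succ | Fst | Snd
| Pair of prog & prog
| Comp of prog & prog
| Rec of prog & prog
| Min of prog.

Inductive computes : prog -> nat -> nat -> Prop :=
| computes_zero n : computes Zero n 0
| computes_succ n : computes Succ n n.+1
| computes_fst a b : computes Fst <| a, b |> a
| computes_snd a b : computes Snd <| a, b |> b
| computes_pair p q n a b :
    computes p n a -> computes q n b -> computes (Pair p q) n <| a, b |>
| computes_comp p q n a b :
    computes q n a -> computes p a b -> computes (Comp p q) n b
| computes_rec0 p q a r :
    computes p a r -> computes (Rec p q) <| a, 0 |> r
| computes_recS p q a n r s :
    computes (Rec p q) <| a, n |> r -> computes q <| a, <| n, r |> |> s ->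
    computes (Rec p q) <| a, n.+1 |> s
| computes_min p a n (r : nat -> nat) :
    computes p <| a, n |> 0 ->
    (forall m, m < n -> computes p <| a, m |> (r m).+1) ->
    computes (Min p) a n.

Fixpoint goedel (phi : formula) : nat :=
  match phi with
  | Less x y => <| 0, <| x, y |> |>
  | Mem x X => <| 1, <| x, X |> |>
  | Not f => <| 2, goedel f |>
  | Or f g => <| 3, <| goedel f, goedel g |> |>
  | AllFO x f => <| 4, <| x, goedel f |> |>
  | AllSO X f => <| 5, <| X, goedel f |> |>
  | Unb X f => <| 6, <| X, goedel f |> |>
  | Almost X f => <| 7, <| X, goedel f |> |>
  end.

Lemma pair_inj a b c d : <| a, b |> = <| c, d |> -> a = c /\ b = d.
Proof. by move=> /Cantor.to_nat_inj[]. Qed.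

Lemma goedel_inj : injective goedel.
Proof.
elim=> [x y|x X|f ih|f ih g ih'|x f ih|X f ih|X f ih|X f ih]
    [y1 y2|y1 y2|f1|f1 f2|y1 f1|y1 f1|y1 f1|y1 f1] /pair_inj[]//= _.
all: try by move=> /pair_inj[-> ->].
all: try by move=> /pair_inj[-> /ih->].
- by move=> /ih->.
- by move=> /pair_inj[/ih-> /ih'->].
Qed.

Lemma computes_det p n a b : computes p n a -> computes p n b -> a = b.
Proof.
move=> h; elim: h b => {p n a} [n|n|a c|a c|p q n a c _ ihp _ ihq
    |p q n a c _ ihq _ ihp|p q a r _ ih|p q a n r s _ ihr _ ihq
    |p a n r _ ih0 _ ihr] b h;
  inversion h; subst; repeat match goal with
    | e : cpair _ _ = cpair _ _ |- _ => case: (pair_inj e) => *; clear e; subst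
    end; try discriminate; auto.
- by apply: ihp; rewrite (ihq _ H1).
- have [? [?]] := pair_inj (f_equal S H1 : <| a0, n0.+1 |> = <| a, n.+1 |>).
  by subst; apply: ihq; rewrite (ihr _ H2).
- case: (ltngtP n b) => // nb.
  + by have := ih0 _ (H1 _ nb).
  + by have := ihr _ nb _ H0.
Qed.

Definition effective (T : formula -> formula) : Prop :=
  exists p : prog, forall phi : formula, computes p (goedel phi) (goedel (T phi)).

(* Main.v *)
(* U X. phi holds iff there are sets B, C and an infinite set D such that, for
   each b in D, the finite set A_b that agrees with B below b and with C from b
   up to the next element of D satisfies phi, and the sizes of the A_b are
   unbounded.  Indeed, a sequence of satisfying sets of growing sizes has, by
   compactness, a subsequence converging to some B, and thinning it out lets
   its terms differ from B on consecutive intervals only, where C records them.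
   Unboundedness is expressed by: for almost all W, only finitely many b in D
   have A_b included in W.  This event has probability 2^-|A_b|; if |A_b| > b
   for all b in D then Borel-Cantelli applies, while if |A_b| <= N for all b in
   D then the limsup of these events has probability at least 2^-N.
   The translation is computed by course-of-values recursion on Goedel numbers;
   fresh variables are obtained by adding 1, 2, 3, 4 to a Goedel number. *)
Require Import Defs.
From mathcomp Require Import all_boot all_order all_algebra.
From mathcomp Require Import finmap all_classical all_reals all_analysis.
From mathcomp Require Import zify lra.
From Stdlib Require Cantor.
Set Implicit Arguments.
Unset Strict Implicit.
Unset Printing Implicit Defensive.
Import Order.TTheory GRing.Theory Num.Theory.
Local Open Scope nat_scope.

(** * Computable functions *)

Definition pfst n := (Cantor.of_nat n).1.
Definition psnd n := (Cantor.of_nat n).2.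

Lemma cpairK n : <| pfst n, psnd n |> = n.
Proof. by rewrite /cpair -surjective_pairing Cantor.cancel_to_of. Qed.

Lemma pfst_cpair a b : pfst <| a, b |> = a.
Proof. by rewrite /pfst Cantor.cancel_of_to. Qed.

Lemma psnd_cpair a b : psnd <| a, b |> = b.
Proof. by rewrite /psnd Cantor.cancel_of_to. Qed.

Lemma leq_cpair a b : a + b <= <| a, b |>.
Proof. by have := Cantor.to_nat_non_decreasing a b; rewrite /cpair; lia. Qed.

Lemma ltn_cpair a b : 0 < a -> b < <| a, b |>.
Proof. by have := leq_cpair a b; lia. Qed.

Definition computable (f : nat -> nat) : Prop :=
  exists p, forall n, computes p n (f n).

Lemma computable_ext f g : f =1 g -> computable f -> computable g.
Proof. by move=> fg [p pf]; exists p => n; rewrite -fg. Qed.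

Lemma computable_fst : computable pfst.
Proof. by exists Fst => n; rewrite -{1}(cpairK n); constructor. Qed.

Lemma computable_snd : computable psnd.
Proof. by exists Snd => n; rewrite -{1}(cpairK n); constructor. Qed.

Lemma computable_cpair f g : computable f -> computable g ->
  computable (fun n => <| f n, g n |>).
Proof. by move=> [p pf] [q qg]; exists (Pair p q) => n; constructor. Qed.

(** No program is the identity outright, but re-pairing the two projections is, because the Cantor
    pairing is onto. *)
Lemma computable_id : computable id.
Proof.
apply: computable_ext (computable_cpair computable_fst computable_snd).
exact: cpairK.
Qed.

Lemma computable_comp f g : computable f -> computable g -> computable (f \o g).
Proof.
by move=> [p pf] [q qg]; exists (Comp p q) => n; exact: computes_comp.
Qed.

Lemma computable_S f : computable f -> computable (fun n => (f n).+1).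
Proof. by apply: (@computable_comp succn); exists Succ; constructor. Qed.

Lemma computable_const k : computable (fun=> k).
Proof. by elim: k => [|k /computable_S//]; exists Zero; constructor. Qed.

(** [Rec] takes its parameter and its counter as one pair, so [x] is first sent to the pair of [x]
    and [cnt x]; the step [h] recovers parameter, index and accumulator by projections. *)
Lemma computable_iteri (cnt base : nat -> nat) (h : nat -> nat -> nat -> nat) :
  computable cnt -> computable base ->
  computable (fun y => h (pfst y) (pfst (psnd y)) (psnd (psnd y))) ->
  computable (fun x => iteri (cnt x) (h x) (base x)).
Proof.
move=> ccnt [p pP] [q qP].
have [s sP] := computable_cpair computable_id ccnt.
exists (Comp (Rec p q) s) => x; apply: computes_comp (sP x) _.
elim: (cnt x) => [|k ih]; first exact: computes_rec0.
apply: computes_recS ih _.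
by move: (qP <| x, <| k, iteri k (h x) (base x) |> |>);
  rewrite !(psnd_cpair, pfst_cpair).
Qed.

Lemma computable_iter (cnt base h : nat -> nat) :
  computable cnt -> computable base -> computable h ->
  computable (fun x => iter (cnt x) h (base x)).
Proof.
move=> cc cb ch.
apply: (@computable_ext (fun x => iteri (cnt x) (fun _ => h) (base x))).
  by move=> x /=; elim: (cnt x) => //= k ->.
apply: (@computable_iteri _ _ (fun _ _ => h)) => //.
apply: computable_comp ch _.
exact: computable_comp computable_snd computable_snd.
Qed.

Lemma computable_pred f : computable f -> computable (fun n => (f n).-1).
Proof.
apply: (@computable_comp predn).
apply: (@computable_ext (fun x => iteri x (fun k _ => k) 0)); first by case.
apply: (@computable_iteri _ _ (fun _ k _ => k)).
- exact: computable_id.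
- exact: computable_const.
- exact: computable_comp computable_fst computable_snd.
Qed.

Lemma computable_sub f g : computable f -> computable g ->
  computable (fun n => f n - g n).
Proof.
move=> cf cg; apply: (@computable_ext (fun n => iter (g n) predn (f n))).
  by move=> n; elim: (g n) => [|k /= ->]; rewrite ?subn0 ?subnS.
exact: computable_iter (computable_pred computable_id).
Qed.

Lemma computable_if_leq f g u v :
  computable f -> computable g -> computable u -> computable v ->
  computable (fun n => if f n <= g n then u n else v n).
Proof.
move=> cf cg cu cv.
(* Iterating a constant step is a case distinction: a zero truncated difference leaves [u n], any
   positive one yields [v n]. *)
apply: (@computable_ext
  (fun n => iteri (f n - g n) (fun _ _ => v n) (u n))).
  by move=> n; rewrite /leq; case: (f n - g n).
apply: (@computable_iteri _ _ (fun n _ _ => v n)) => //.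
- exact: computable_sub.
- exact: computable_comp cv computable_fst.
Qed.

Section course_of_values.
Variable t : nat -> nat -> nat.
Hypothesis ct : computable (fun y => t (pfst y) (psnd y)).

(* The values at n - 1, ..., 0 of the function being defined. *)
Definition history n := iteri n (fun k r => <| t k r, r |>) 0.

(** The latest value is outermost in [history n], so the value at [i] lies under [n.-1 - i] second
    projections. *)
Definition lookup n r i := pfst (iter (n.-1 - i) psnd r).

Definition cov n := t n (history n).

Lemma lookupE n i : i < n -> lookup n (history n) i = cov i.
Proof.
move=> i_n; rewrite /lookup.
have [d ->] : exists d, n = (i + d).+1 by exists (n - i.+1); lia.
rewrite [_.-1 - i]addKn.
suff -> : iter d psnd (history (i + d).+1) = history i.+1.
  exact: pfst_cpair.
by elim: d => [|d ih]; [rewrite addn0|rewrite iterSr addnS /= psnd_cpair].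
Qed.

Lemma computable_cov : computable cov.
Proof.
have ch : computable history.
  apply: (@computable_iteri _ _ (fun _ k r => <| t k r, r |>)).
  - exact: computable_id.
  - exact: computable_const.
  - apply: computable_cpair.
      exact: (computable_comp ct computable_snd).
    exact: computable_comp computable_snd computable_snd.
apply: computable_ext (computable_comp ct (computable_cpair computable_id ch)).
by move=> n /=; rewrite pfst_cpair psnd_cpair.
Qed.

End course_of_values.

Lemma computable_lookup f g h : computable f -> computable g -> computable h ->
  computable (fun n => lookup (f n) (g n) (h n)).
Proof.
move=> cf cg ch; apply: computable_comp computable_fst _.
apply: computable_iter => //; last exact: computable_snd.
by apply: computable_sub => //; exact: computable_pred.
Qed.

(** The function [e] may depend on the subformula only through its Goedel number, which is all that
    a recursion on codes has at hand. *)
Definition formula_computable (e : nat -> nat -> formula -> nat) : Prop :=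
  exists2 h, computable h &
    forall n X g, e n X g = h <| n, <| X, goedel g |> |>.

Lemma formula_computable_code : formula_computable (fun _ _ g => goedel g).
Proof.
exists (psnd \o psnd); first exact: computable_comp computable_snd computable_snd.
by move=> n X g; rewrite /= !psnd_cpair.
Qed.

Lemma formula_computable1 : formula_computable (fun n _ _ => n).
Proof. by exists pfst => [|n X g]; [exact: computable_fst|rewrite pfst_cpair]. Qed.

Lemma formula_computable2 : formula_computable (fun _ X _ => X).
Proof.
exists (pfst \o psnd); first exact: computable_comp computable_fst computable_snd.
by move=> n X g; rewrite /= psnd_cpair pfst_cpair.
Qed.

Lemma formula_computable_const k : formula_computable (fun _ _ _ => k).
Proof. by exists (fun=> k) => //; exact: computable_const. Qed.

Lemma formula_computable_S e : formula_computable e ->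
  formula_computable (fun n X g => (e n X g).+1).
Proof.
by move=> [h ch hE]; exists (succn \o h) => [|n X g];
  [exact: computable_S|rewrite hE].
Qed.

Lemma formula_computable_cpair e e' :
  formula_computable e -> formula_computable e' ->
  formula_computable (fun n X g => <| e n X g, e' n X g |>).
Proof.
move=> [h ch hE] [h' ch' hE'].
exists (fun x => <| h x, h' x |>); first exact: computable_cpair.
by move=> n X g; rewrite hE hE'.
Qed.

(** * The translation *)

Definition And f g := Not (Or (Not f) (Not g)).
Definition Imp f g := Or (Not f) g.
Definition ExFO x f := Not (AllFO x (Not f)).
Definition ExSO X f := Not (AllSO X (Not f)).

(* c belongs to "slice b": the part of the set variable n.+1 below b, and the
   part of n.+2 between b and the next element of n.+3. *)
Definition in_slice n b c : formula :=
  Or (And (Less c b) (Defs.Mem c n.+1))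
     (And (And (Not (Less c b)) (Defs.Mem c n.+2))
          (AllFO n.+3 (Imp (And (Defs.Mem n.+3 n.+3) (Less b n.+3)) (Less c n.+3)))).

(** The set variables [n.+1], [n.+2], [n.+3] stand for B, C, D throughout. A first-order variable
    with the same number is a different variable, so both kinds share the numbers. *)
Definition infinite n : formula :=
  AllFO n.+1 (ExFO n.+2 (And (Less n.+1 n.+2) (Defs.Mem n.+2 n.+3))).

(** Substitution of a slice for [X] in [f] is simulated by quantifying over all [X] with the same
    elements as the slice, which leaves [f] untouched. *)
Definition slices_sat n X f : formula :=
  AllFO n.+1 (Imp (Defs.Mem n.+1 n.+3) (AllSO X (Imp
    (AllFO n.+2 (And (Imp (Defs.Mem n.+2 X) (in_slice n n.+1 n.+2))
                     (Imp (in_slice n n.+1 n.+2) (Defs.Mem n.+2 X)))) f))).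

(** The Borel-Cantelli condition: the set variable [n.+4] is the random set W, and the first-order
    [n.+4] is the bound after which no slice is included in W. *)
Definition slices_unbounded n : formula :=
  Almost n.+4 (ExFO n.+4 (AllFO n.+1
    (Imp (And (Defs.Mem n.+1 n.+3) (Less n.+4 n.+1))
         (ExFO n.+2 (And (in_slice n n.+1 n.+2) (Not (Defs.Mem n.+2 n.+4))))))).

(* The variables n.+1, ..., n.+4 must not be free in f. *)
Definition unb_almost n X f : formula :=
  ExSO n.+1 (ExSO n.+2 (ExSO n.+3
    (And (infinite n) (And (slices_sat n X f) (slices_unbounded n))))).

(* The Goedel number of a formula bounds the variables occurring in it. *)
Fixpoint translate (phi : formula) : formula :=
  match phi with
  | Less _ _ | Defs.Mem _ _ => phi
  | Not f => Not (translate f)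
  | Or f g => Or (translate f) (translate g)
  | AllFO x f => AllFO x (translate f)
  | AllSO X f => AllSO X (translate f)
  | Unb X f => unb_almost (goedel phi) X (translate f)
  | Almost X f => Almost X (translate f)
  end.

Lemma formula_computable_unb_almost :
  formula_computable (fun n X f => goedel (unb_almost n X f)).
Proof.
rewrite /unb_almost /slices_sat /slices_unbounded /infinite /in_slice.
rewrite /And /Imp /ExFO /ExSO /=.
repeat first
  [ exact: formula_computable_code | exact: formula_computable1
  | exact: formula_computable2 | exact: formula_computable_const
  | apply: formula_computable_cpair | apply: formula_computable_S ].
Qed.

Lemma effective_translate : effective translate.
Proof.
have [h ch hE] := formula_computable_unb_almost.
(* Tags 0 and 1 are the atoms, 2 is negation, 3 is disjunction; 4, 5 and 7 are binders kept as they
   are, and 6 is [Unb]. Every recursive call is at a component of a pair with positive tag, hence at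
   a smaller number. *)
pose t n r := let tag := pfst n in let arg := psnd n in
  let L := lookup n r in
  let bind := <| tag, <| pfst arg, L (psnd arg) |> |> in
  if tag <= 1 then n else
  if tag <= 2 then <| tag, L arg |> else
  if tag <= 3 then <| tag, <| L (pfst arg), L (psnd arg) |> |> else
  if tag <= 5 then bind else
  if tag <= 6 then h <| n, <| pfst arg, L (psnd arg) |> |> else bind.
have ct : computable (fun y => t (pfst y) (psnd y)).
  have cn := computable_fst; have cr := computable_snd.
  have ctag := computable_comp computable_fst cn.
  have carg := computable_comp computable_snd cn.
  have carg1 := computable_comp computable_fst carg.
  have carg2 := computable_comp computable_snd carg.
  have cL (f : nat -> nat) (cf : computable f) := computable_lookup cn cr cf.
  have cbind := computable_cpair ctag (computable_cpair carg1 (cL _ carg2)).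
  apply: (computable_if_leq ctag (computable_const _) cn).
  apply: (computable_if_leq ctag (computable_const _)
    (computable_cpair ctag (cL _ carg))).
  apply: (computable_if_leq ctag (computable_const _) (computable_cpair ctag
    (computable_cpair (cL _ carg1) (cL _ carg2)))).
  apply: (computable_if_leq ctag (computable_const _) cbind).
  apply: (computable_if_leq ctag (computable_const _) _ cbind).
  apply: (computable_comp ch).
  exact: computable_cpair cn (computable_cpair carg1 (cL _ carg2)).
have [p pP] := computable_cov ct.
exists p => phi; suff <- : cov t (goedel phi) = goedel (translate phi) by [].
have lt1 k a b : 0 < k -> a < <| k, <| a, b |> |>.
  by move=> k0; have := leq_cpair a b; have := ltn_cpair <| a, b |> k0; lia.
have lt2 k a b : 0 < k -> b < <| k, <| a, b |> |>.
  by move=> k0; have := leq_cpair a b; have := ltn_cpair <| a, b |> k0; lia.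
have covE k a : cov t <| k, a |> = let L := lookup <| k, a |> (history t <| k, a |>) in
    let bind := <| k, <| pfst a, L (psnd a) |> |> in
    if k <= 1 then <| k, a |> else if k <= 2 then <| k, L a |> else
    if k <= 3 then <| k, <| L (pfst a), L (psnd a) |> |> else
    if k <= 5 then bind else
    if k <= 6 then h <| <| k, a |>, <| pfst a, L (psnd a) |> |> else bind.
  by rewrite /cov {1}/t pfst_cpair psnd_cpair.
elim: phi => [x y|x X|f ih|f ih g ih'|x f ih|X f ih|X f ih|X f ih];
  rewrite ?[goedel (translate (Unb _ _))]hE covE /=.
all: by rewrite ?(pfst_cpair, psnd_cpair) ?lookupE ?ltn_cpair ?lt1 ?lt2 ?ih ?ih'.
Qed.

Lemma in_S1S_Almost_translate phi : in_S1S_Almost (translate phi).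
Proof. by elim: phi => //= [f -> g ->|X f ->]. Qed.

Lemma leq_goedel_free phi x :
  (x \in free_fo phi) || (x \in free_so phi) -> x <= goedel phi.
Proof.
have le k a b : (a <= <| k, <| a, b |> |>) && (b <= <| k, <| a, b |> |>).
  by have := leq_cpair a b; have := leq_cpair k <| a, b |>; lia.
elim: phi => [y z|y Z|f ih|f ih g ih'|y f ih|Z f ih|Z f ih|Z f ih] /=;
  rewrite ?inE ?mem_cat ?mem_filter.
- by have := le 0 y z; do 2![case: eqP => [->|_]]; lia.
- by have := le 1 y Z; do 2![case: eqP => [->|_]]; lia.
- by move=> /ih; have := leq_cpair 2 (goedel f); lia.
- have := le 3 (goedel f) (goedel g).
  by move=> ? /orP[] /orP[] h; [have := ih|have := ih'|have := ih|have := ih'];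
    rewrite h ?orbT => /(_ isT); lia.
- by have := le 4 y (goedel f) => ? h; have := ih; case: (x \in _) h => /=;
    case: (x \in _); rewrite ?andbF //= => _ /(_ isT); lia.
all: have := le 5 Z (goedel f); have := le 6 Z (goedel f);
  have := le 7 Z (goedel f).
all: by move=> ? ? ? h; have := ih; move: h; case: (x \in _) => /=;
    case: (x \in _); rewrite ?andbF //= => _ /(_ isT); lia.
Qed.

(** * Free variables and satisfaction *)

(** Bundled as one rewriting rule, these turn membership in the free variables of a large formula
    into a Boolean combination of equalities. *)
Lemma mem_free_fo x :
  ((forall y z, (x \in free_fo (Less y z)) = (x == y) || (x == z)) *
   (forall y Z, (x \in free_fo (Defs.Mem y Z)) = (x == y)) *
   (forall f, (x \in free_fo (Not f)) = (x \in free_fo f)) *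
   (forall f g, (x \in free_fo (Or f g)) =
      (x \in free_fo f) || (x \in free_fo g)) *
   (forall y f, (x \in free_fo (AllFO y f)) = (x != y) && (x \in free_fo f)) *
   (forall Y f, (x \in free_fo (AllSO Y f)) = (x \in free_fo f)) *
   (forall Y f, (x \in free_fo (Almost Y f)) = (x \in free_fo f)))%type.
Proof.
by do ?[apply: pair] => *; rewrite /= ?mem_cat ?mem_filter ?inE.
Qed.

Lemma mem_free_so x :
  ((forall y z, (x \in free_so (Less y z)) = false) *
   (forall y Z, (x \in free_so (Defs.Mem y Z)) = (x == Z)) *
   (forall f, (x \in free_so (Not f)) = (x \in free_so f)) *
   (forall f g, (x \in free_so (Or f g)) =
      (x \in free_so f) || (x \in free_so g)) *
   (forall y f, (x \in free_so (AllFO y f)) = (x \in free_so f)) *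
   (forall Y f, (x \in free_so (AllSO Y f)) = (x != Y) && (x \in free_so f)) *
   (forall Y f, (x \in free_so (Almost Y f)) = (x != Y) && (x \in free_so f)))%type.
Proof.
by do ?[apply: pair] => *; rewrite /= ?mem_cat ?mem_filter ?inE.
Qed.

(** Each auxiliary variable is bound wherever the construction introduces it, and capturing a
    variable of [f] could only remove free ones. *)
Lemma free_fo_unb_almost n X f : {subset free_fo (unb_almost n X f) <= free_fo f}.
Proof.
move=> x; rewrite /unb_almost /slices_sat /slices_unbounded /infinite /in_slice.
rewrite /And /Imp /ExFO /ExSO !mem_free_fo.
by case: (x == n.+1); case: (x == n.+2); case: (x == n.+3); case: (x == n.+4);
  case: (x \in _).
Qed.

Lemma free_so_unb_almost n X f :
  {subset free_so (unb_almost n X f) <= free_so (Unb X f)}.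
Proof.
move=> x; rewrite /unb_almost /slices_sat /slices_unbounded /infinite /in_slice.
rewrite /And /Imp /ExFO /ExSO !mem_free_so /= ?mem_filter.
by case: (x == n.+1); case: (x == n.+2); case: (x == n.+3); case: (x == n.+4);
  case: (x == X); case: (x \in _).
Qed.

(** Fresh variables are chosen from the code of the untranslated formula, so they stay fresh for the
    translated subformula only if translation creates no free variables. *)
Lemma free_fo_translate f : {subset free_fo (translate f) <= free_fo f}.
Proof.
elim: f => [y z|y X|f ih|f ihf g ihg|y f ih|X f ih|X f ih|X f ih] x //.
- exact: ih.
- by rewrite !mem_free_fo => /orP[/ihf|/ihg] ->; rewrite ?orbT.
- by rewrite !mem_free_fo => /andP[-> /ih].
- exact: ih.
- by move=> /free_fo_unb_almost /ih.
- exact: ih.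
Qed.

Lemma free_so_translate f : {subset free_so (translate f) <= free_so f}.
Proof.
elim: f => [y z|y X|f ih|f ihf g ihg|y f ih|X f ih|X f ih|X f ih] x //.
- exact: ih.
- by rewrite !mem_free_so => /orP[/ihf|/ihg] ->; rewrite ?orbT.
- exact: ih.
- by rewrite !mem_free_so => /andP[-> /ih].
- by move=> /free_so_unb_almost; rewrite !mem_filter => /andP[-> /ih].
- by rewrite !mem_free_so => /andP[-> /ih].
Qed.

Section sat.
Variable R : realType.
Implicit Types (v : nat -> nat) (V : nat -> word) (f g : formula).

Lemma eq_ae (P Q : word -> Prop) : (forall W, P W = Q W) ->
  (\forall W \ae coin R, P W) = (\forall W \ae coin R, Q W).
Proof. by move=> /funext ->. Qed.

(** Coincidence lemma, phrased as an equality of propositions so that it rewrites under quantifiers,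
    the almost-everywhere one included. *)
Lemma eq_sat v v' V V' f :
  {in free_fo f, v =1 v'} -> {in free_so f, V =1 V'} ->
  sat R v V f = sat R v' V' f.
Proof.
have upd (T : Type) (u u' : nat -> T) x k s : {in [seq y <- s | y != x], u =1 u'} ->
    {in s, [eta u with x |-> k] =1 [eta u' with x |-> k]}.
  by move=> uu y ys /=; case: eqP => // /eqP yx; apply: uu; rewrite mem_filter yx.
elim: f v v' V V' => [x y|x X|f ih|f ihf g ihg|x f ih|X f ih|X f ih|X f ih]
    v v' V V' vv VV /=.
- by rewrite !vv ?inE ?eqxx ?orbT.
- by rewrite vv ?VV ?inE ?eqxx.
- by rewrite (ih v v' V V').
- rewrite (ihf v v' V V') ?(ihg v v' V V')// => x xf.
  + by apply: vv; rewrite mem_cat xf orbT.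
  + by apply: VV; rewrite mem_cat xf orbT.
  + by apply: vv; rewrite mem_cat xf.
  + by apply: VV; rewrite mem_cat xf.
- by apply: eq_forall => k; apply: ih => //; exact: upd.
- by apply: eq_forall => W; apply: ih => //; exact: upd.
- apply: eq_forall => n; congr (exists2 _, _ & _); apply/funext => A.
  by apply: ih => //; exact: upd.
- apply: eq_ae => W; apply: ih => //; exact: upd.
Qed.

Lemma sat_And v V f g : sat R v V (And f g) = (sat R v V f /\ sat R v V g).
Proof. by rewrite /= not_orE !not_notE. Qed.

Lemma sat_Or v V f g : sat R v V (Or f g) = (sat R v V f \/ sat R v V g).
Proof. by []. Qed.

Lemma sat_AllFO v V x f :
  sat R v V (AllFO x f) = forall k, sat R [eta v with x |-> k] V f.
Proof. by []. Qed.

Lemma sat_AllSO v V X f :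
  sat R v V (AllSO X f) = forall W, sat R v [eta V with X |-> W] f.
Proof. by []. Qed.

Lemma sat_Almost v V X f : sat R v V (Almost X f) =
  \forall W \ae coin R, sat R v [eta V with X |-> (W : word)] f.
Proof. by []. Qed.

Lemma sat_Imp v V f g : sat R v V (Imp f g) = (sat R v V f -> sat R v V g).
Proof. by rewrite implyE. Qed.

Lemma sat_ExFO v V x f :
  sat R v V (ExFO x f) = exists k, sat R [eta v with x |-> k] V f.
Proof. by rewrite /= -[RHS]not_notE -forallNE. Qed.

Lemma sat_ExSO v V X f :
  sat R v V (ExSO X f) = exists W, sat R v [eta V with X |-> W] f.
Proof. by rewrite /= -[RHS]not_notE -forallNE. Qed.

(** Semantic counterpart of [in_slice]. If D had no element beyond [b], the part taken from C would
    be unrestricted; infinity of D excludes this. *)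
Definition slice (B C D : word) b : word :=
  fun c => if c < b then B c else C c && `[< forall d, D d -> b < d -> c < d >].

(** The inner quantifier of [in_slice] binds the first-order variable [n.+3], so [b] and [c] must
    avoid it. *)
Lemma sat_in_slice v V n b c : b != n.+3 -> c != n.+3 ->
  sat R v V (in_slice n b c) =
  slice (V n.+1) (V n.+2) (V n.+3) (v b) (v c).
Proof.
move=> bn cn.
have e d : sat R [eta v with n.+3 |-> d] V
    (Imp (And (Defs.Mem n.+3 n.+3) (Less b n.+3)) (Less c n.+3)) =
    (V n.+3 d /\ v b < d -> v c < d).
  by rewrite sat_Imp sat_And /= eqxx (negbTE bn) (negbTE cn).
rewrite /in_slice sat_Or !sat_And sat_AllFO (eq_forall e) /slice /=.
apply/propext; case: ifP => cb; split.
- by case=> [[]//|[[]]].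
- by left.
- case=> [[]//|[[_ ->]] H /=]; apply/asboolP => d Dd bd.
  exact: H (conj Dd bd).
- move=> /andP[-> /asboolP H]; right; split => // d [Dd bd].
  exact: H.
Qed.

Lemma fresh_neq n :
  ((n.+1 == n.+2 = false) * (n.+2 == n.+1 = false) *
   (n.+1 == n.+3 = false) * (n.+3 == n.+1 = false) *
   (n.+2 == n.+3 = false) * (n.+3 == n.+2 = false) *
   (n.+1 == n.+4 = false) * (n.+4 == n.+1 = false) *
   (n.+2 == n.+4 = false) * (n.+4 == n.+2 = false) *
   (n.+3 == n.+4 = false) * (n.+4 == n.+3 = false))%type.
Proof. by do ?[apply: pair]; apply/eqP; lia. Qed.

Lemma sat_infinite v V n :
  sat R v V (infinite n) = forall m, exists2 d, m < d & V n.+3 d.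
Proof.
rewrite /infinite sat_AllFO; apply: eq_forall => m; rewrite sat_ExFO.
apply/propext; split => [[d]|[d md Dd]]; last exists d.
all: rewrite sat_And /= !eqxx !fresh_neq //.
by case=> md Dd; exists d.
Qed.

Lemma sat_slices_sat v V n X f :
  X <= n -> (forall x, x \in free_fo f -> x <= n) ->
  sat R v V (slices_sat n X f) = forall b, V n.+3 b ->
    sat R v [eta V with X |-> slice (V n.+1) (V n.+2) (V n.+3) b] f.
Proof.
move=> Xn fn; rewrite /slices_sat sat_AllFO; apply: eq_forall => b.
have [n1X n2X n3X] : [/\ (n.+1 == X) = false, (n.+2 == X) = false &
  (n.+3 == X) = false] by split; apply/eqP; lia.
rewrite sat_Imp sat_AllSO [sat R _ _ (Defs.Mem _ _)]/= eqxx; set S := slice _ _ _ b.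
(* By extensionality the guard forces [W] to be the slice, so the universal quantifier over [X]
   collapses to one instance. As [X] is not one of the fresh variables, assigning it leaves B, C, D
   unchanged. *)
have e W : sat R [eta v with n.+1 |-> b] [eta V with X |-> W]
    (AllFO n.+2 (And (Imp (Defs.Mem n.+2 X) (in_slice n n.+1 n.+2))
       (Imp (in_slice n n.+1 n.+2) (Defs.Mem n.+2 X)))) = (W = S).
  rewrite sat_AllFO; apply/propext; split => [H|->]; last first.
    move=> k; rewrite sat_And (sat_Imp _ _ (Defs.Mem _ _)) (sat_Imp _ _ (in_slice _ _ _)).
    rewrite sat_in_slice ?fresh_neq//=.
    by rewrite n1X n2X n3X !eqxx !fresh_neq.
  apply/funext => k; have := H k.
  rewrite sat_And (sat_Imp _ _ (Defs.Mem _ _)) (sat_Imp _ _ (in_slice _ _ _)).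
  rewrite sat_in_slice ?fresh_neq//=.
  rewrite n1X n2X n3X !eqxx !fresh_neq -/S.
  by case: (W k) (S k) => -[] [] // h1 h2; [have := h1 isT|have := h2 isT].
congr (_ -> _); under eq_forall => W do rewrite sat_Imp e.
have fE W : sat R [eta v with n.+1 |-> b] [eta V with X |-> W] f =
    sat R v [eta V with X |-> W] f.
  apply: eq_sat => // x /fn xn /=; case: eqP => // xE; lia.
by apply/propext; split => [/(_ S erefl)|H W ->]; rewrite fE.
Qed.

Lemma sat_slices_unbounded v V n : sat R v V (slices_unbounded n) =
  \forall W \ae coin R, exists z, forall b, V n.+3 b -> z < b ->
    exists2 c, slice (V n.+1) (V n.+2) (V n.+3) b c & ~~ W c.
Proof.
rewrite /slices_unbounded sat_Almost; apply: eq_ae => W; rewrite sat_ExFO.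
congr (exists _, _); apply/funext => z.
rewrite sat_AllFO; apply: eq_forall => b.
rewrite sat_Imp sat_And sat_ExFO.
rewrite [sat R _ _ (Defs.Mem _ _)]/= [sat R _ _ (Less _ _)]/= !eqxx !fresh_neq.
have E c : sat R
    [eta [eta [eta v with n.+4 |-> z] with n.+1 |-> b] with n.+2 |-> c]
    [eta V with n.+4 |-> W]
    (And (in_slice n n.+1 n.+2) (Not (Defs.Mem n.+2 n.+4))) =
  (slice (V n.+1) (V n.+2) (V n.+3) b c /\ ~~ W c).
  rewrite sat_And sat_in_slice ?fresh_neq//= !eqxx !fresh_neq.
  by congr (_ /\ _); apply/propext; split => /negP.
apply/propext; split => [H Db zb|H [Db zb]].
  by have [c] := H (conj Db zb); rewrite E => -[]; exists c.
by have [c] := H Db zb; exists c; rewrite E.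
Qed.

Lemma sat_unb_almost v V n X f : X <= n ->
  (forall x, x \in free_fo f -> x <= n) ->
  (forall Y, Y \in free_so f -> Y <= n) ->
  sat R v V (unb_almost n X f) = exists B C D : word,
    [/\ forall m, exists2 d, m < d & D d,
        forall b, D b -> sat R v [eta V with X |-> slice B C D b] f &
        \forall W \ae coin R, exists z, forall b, D b -> z < b ->
          exists2 c, slice B C D b c & ~~ W c].
Proof.
move=> Xn fn sn; rewrite /unb_almost sat_ExSO.
congr (exists _, _); apply/funext => B; rewrite sat_ExSO.
congr (exists _, _); apply/funext => C; rewrite sat_ExSO.
congr (exists _, _); apply/funext => D.
set V' := [eta _ with n.+3 |-> D].
rewrite !sat_And sat_infinite sat_slices_sat// sat_slices_unbounded.
have -> : V' n.+1 = B by rewrite /V' /= !eqxx !fresh_neq.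
have -> : V' n.+2 = C by rewrite /V' /= !eqxx !fresh_neq.
have -> : V' n.+3 = D by rewrite /V' /= !eqxx.
have fE b : sat R v [eta V' with X |-> slice B C D b] f =
    sat R v [eta V with X |-> slice B C D b] f.
  apply: eq_sat => // Y /sn Yn; rewrite /V' /=; case: eqP => // _.
  by case: eqP => [?|_]; [lia|case: eqP => [?|_]; [lia|case: eqP => [?|_]; [lia|]]].
apply/propext; split => [[Dinf [DP Dae]]|[Dinf DP Dae]].
  by split => // b /DP; rewrite fE.
by do ?[split] => // b /DP; rewrite fE.
Qed.

End sat.

(** * Random supersets of finite sets *)

Section measure.
Variable R : realType.
Local Open Scope ring_scope.
Local Open Scope classical_set_scope.

Lemma measurable_cylinder s : measurable (cylinder s : set coin_space).
Proof. by apply: sub_sigma_algebra; exists s. Qed.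

(** Interpolates between a cylinder, at [k = 0], and the event that [A] is included in [w], at empty
    [s] and large [k]; its probability then follows by induction on [k]. *)
Let agree (A : {fset nat}) s k : set coin_space :=
  cylinder s `&` [set w | forall i, i \in iota (size s) k -> i \in A -> w i].

Let agree0 A s : agree A s 0 = cylinder s.
Proof. by rewrite /agree (_ : [set w | _] = setT) ?setIT//; apply/seteqP. Qed.

Let agreeS A s k : agree A s k.+1 =
  (if size s \in A then set0 else agree A (rcons s false) k) `|`
  agree A (rcons s true) k.
Proof.
have cylE w b : cylinder (rcons s b) w = (cylinder s w /\ w (size s) = b).
  rewrite /cylinder /= size_rcons mkseqS; apply/propext; split.
    by move=> /rcons_inj[].
  by case=> -> ->.
have step w b : agree A (rcons s b) k w = [/\ cylinder s w, w (size s) = b &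
    forall i, i \in iota (size s).+1 k -> i \in A -> w i].
  rewrite /agree /= cylE size_rcons; apply/propext.
  by split => [[[]]|[]].
apply/seteqP; split => w.
  move=> [ws wA]; have wA' i : i \in iota (size s).+1 k -> i \in A -> w i.
    by move=> ik; apply: wA; rewrite inE ik orbT.
  case E: (w (size s)); first by right; rewrite step.
  left; case: ifP => [sA|_]; last by rewrite step.
  by move: (wA (size s)); rewrite inE eqxx E => /(_ isT sA).
case; last first.
  rewrite step => -[ws wt wA]; split => //= i; rewrite inE.
  by move=> /orP[/eqP -> //|]; exact: wA.
case: ifPn => // sA; rewrite step => -[ws wt wA]; split => //= i; rewrite inE.
by move=> /orP[/eqP -> /(negP sA)//|]; exact: wA.
Qed.

Let measurable_agree A s k : measurable (agree A s k).
Proof.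
elim: k s => [|k ih] s; first by rewrite agree0; exact: measurable_cylinder.
by rewrite agreeS; apply: measurableU => //; case: ifP.
Qed.

(** Each position in [A] costs a factor 1/2, while at any other position the two equal halves add up
    again. *)
Let coin_agree A s k : coin R (agree A s k) =
  ((2 ^+ (size s + count (mem A) (iota (size s) k)))^-1)%:E.
Proof.
elim: k s => [|k ih] s; first by rewrite agree0 addn0 coin_cylinder.
rewrite agreeS measureU//; last 2 first.
- by case: ifP.
- apply/seteqP; split => // w; case: ifP => [_ []//|_].
  rewrite /agree /cylinder /= !size_rcons !mkseqS.
  by move=> [[/rcons_inj[_ wF] _] [/rcons_inj[_ wT] _]]; rewrite wF in wT.
have := ih (rcons s false); have := ih (rcons s true).
rewrite !size_rcons /= => -> e; rewrite -!topredE /=.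
case: ifP => _; first by rewrite measure0 add0e add1n addnS addSn.
rewrite e add0n -EFinD addSn exprS invfM; congr (_%:E).
by rewrite -mulrDl; have -> : 2^-1 + 2^-1 = 1 :> R by [lra]; rewrite mul1r.
Qed.

Let superset_agree (A : {fset nat}) m : (forall i, i \in A -> (i < m)%N) ->
  [set w : coin_space | forall i, i \in A -> w i] = agree A [::] m.
Proof.
move=> Am; apply/seteqP; split => w /=; rewrite /agree /cylinder /=.
  by move=> wA; split => // i _; exact: wA.
by move=> [_ wA] i iA; apply: wA => //; rewrite mem_iota add0n Am.
Qed.

Let fset_bound (A : {fset nat}) : exists m, forall i, i \in A -> (i < m)%N.
Proof.
exists (\max_(i <- enum_fset A) i).+1%N => i iA.
by rewrite ltnS; apply: (@leq_bigmax_seq _ (enum_fset A) xpredT id).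
Qed.

Lemma measurable_superset (A : {fset nat}) :
  measurable [set w : coin_space | forall i, i \in A -> w i].
Proof. by have [m /superset_agree ->] := fset_bound A. Qed.

Lemma coin_superset (A : {fset nat}) :
  coin R [set w : coin_space | forall i, i \in A -> w i] =
  ((2 ^+ #|` A|%fset)^-1)%:E.
Proof.
have [m Am] := fset_bound A.
rewrite (superset_agree Am) coin_agree add0n -size_filter.
suff /perm_size -> : perm_eq [seq x <- iota 0 m | mem A x] (enum_fset A) by [].
apply: uniq_perm; rewrite ?filter_uniq ?iota_uniq// => i.
rewrite mem_filter mem_iota /=; apply/andP/idP => [[]//|iA].
by split => //; exact: Am.
Qed.

Implicit Types (D : word) (A : nat -> {fset nat}).

(** Empty events off D give a sequence over all naturals whose limsup sees only the elements of
    D. *)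
Let supersets D A b : set coin_space :=
  if D b then [set w : coin_space | forall i, i \in A b -> w i] else set0.

Let measurable_supersets D A b : measurable (supersets D A b).
Proof. by rewrite /supersets; case: ifP => // _; exact: measurable_superset. Qed.

Let lim_sup_supersets D A : lim_sup_set (supersets D A) =
  ~` [set w : coin_space | exists z, forall b, D b -> (z < b)%N ->
    exists2 c, c \in A b & ~~ w c].
Proof.
apply/seteqP; split => w.
  (* The tails of a limsup include their first index, so the tail from [z.+1] yields the strict
     [z < b]. *)
  move=> wD [z wz]; have [b /= zb] := wD z.+1 I.
  rewrite /supersets; case: ifP => // Db wb.
  by have [c cA] := wz b Db zb; rewrite (wb c cA).
move=> wN z _; apply: contrapT => wz; apply: wN; exists z => b Db zb.
apply: contrapT => wb; apply: wz; exists b; first exact: ltnW.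
rewrite /supersets Db => c cA /=; apply: contrapT => /negP wc.
by apply: wb; exists c.
Qed.

Let ae_lim_sup D A :
  (\forall w \ae coin R, exists z, forall b, D b -> (z < b)%N ->
    exists2 c, c \in A b & ~~ w c) =
  (coin R).-negligible (lim_sup_set (supersets D A)).
Proof. by rewrite lim_sup_supersets. Qed.

(** First Borel-Cantelli lemma: the event at [b] has probability at most 2^-(b+1), and these bounds
    have a finite sum. *)
Lemma ae_not_superset D A : (forall b, D b -> (b < #|` A b|%fset)%N) ->
  \forall w \ae coin R, exists z, forall b, D b -> (z < b)%N ->
    exists2 c, c \in A b & ~~ w c.
Proof.
move=> DA; rewrite ae_lim_sup.
have mF := measurable_supersets D A.
apply/negligibleP.
  apply: bigcap_measurable => // k _.
  by apply: bigcup_measurable => j /= _; exact: mF.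
apply: lim_sup_set_cvg0 => //.
apply: (@le_lt_trans _ _ (\sum_(i <oo) (1 / (2 ^ i.+1)%:R)%:E)%E); last first.
  exact: le_lt_trans (epsilon_trick0 xpredT (@ler01 R)) (ltry _).
apply: lee_nneseries => // b _; rewrite /supersets; case: ifP => Db; last first.
  by rewrite measure0 lee_fin divr_ge0.
rewrite [leLHS]coin_superset lee_fin div1r lef_pV2 ?posrE ?exprn_gt0 ?ltr0n ?expn_gt0//.
by rewrite natrX ler_weXn2l ?ler1n//; exact: DA.
Qed.

(* The events "A b is a subset of w" have probability at least 2^-N, hence so
   has their limsup. *)
Lemma not_ae_not_superset D A N : (forall m, exists2 d, (m < d)%N & D d) ->
  (forall b, D b -> (#|` A b|%fset <= N)%N) ->
  ~ \forall w \ae coin R, exists z, forall b, D b -> (z < b)%N ->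
    exists2 c, c \in A b & ~~ w c.
Proof.
move=> Dinf DA; rewrite ae_lim_sup.
have mF := measurable_supersets D A.
have mU n : measurable (\bigcup_(k >= n) supersets D A k).
  by apply: bigcup_measurable => j /= _; exact: mF.
rewrite negligibleP; last exact: bigcap_measurable.
move=> /= lim0.
(* Continuity from above: the probabilities of the tail unions converge to that of the limsup, so a
   lower bound on every tail passes to the limit. *)
have := lim_sup_set_cvg (coin R) (supersets D A) mF.
rewrite -ge0_fin_numE// fin_num_measure// => /(_ isT) cvgF.
have : ((2 ^+ N)^-1%:E <= coin R (lim_sup_set (supersets D A)))%E.
  apply: (cvge_to_ge cvgF); apply: nearW => n.
  have [d nd Dd] := Dinf n.
  apply: (@le_trans _ _ (coin R (supersets D A d))).
    rewrite /supersets Dd [leRHS]coin_superset lee_fin.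
    by rewrite lef_pV2 ?posrE ?exprn_gt0// ler_weXn2l ?ler1n// DA.
  apply: le_measure; rewrite ?inE//.
  by move=> w wd; exists d => //=; exact: ltnW.
rewrite [X in (_ <= X)%E]lim0 lee_fin leNgt invr_gt0 exprn_gt0//.
Qed.

End measure.

(** * Compactness *)

Section compactness.
Variable P : word -> Prop.
Hypothesis unbounded :
  forall n, exists2 A : {fset nat}, n < #|` A|%fset & P (fun k => k \in A).

(** The nodes of a Koenig-style argument: prefixes shared by satisfying finite sets of arbitrarily
    large size. *)
Let good s := forall n, exists A : {fset nat},
  [/\ n < #|` A|%fset, P (fun k => k \in A) &
      mkseq (fun k => k \in A) (size s) = s].

(** If the extension by 1 has no witness of size above [n0], then every larger witness for [s]
    continues with 0. *)
Let good_rcons s : good s -> ~ good (rcons s true) -> good (rcons s false).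
Proof.
move=> gs /existsNP[n0 n0P] n.
have [A [nA PA As]] := gs (maxn n0 n); exists A; split => //; first lia.
rewrite size_rcons mkseqS As; case E: (size s \in A) => //.
case: n0P; exists A; split => //; first lia.
by rewrite size_rcons mkseqS As E.
Qed.

(** A branch through good prefixes, taking the letter 1 whenever the result is still good; its limit
    is B. *)
Let prefix k := iter k (fun s => rcons s `[< good (rcons s true) >]) [::].

Lemma exists_limit : exists B : word, forall m, exists A : {fset nat},
  [/\ m < #|` A|%fset, P (fun k => k \in A) &
      forall i, i < m -> (i \in A) = B i].
Proof.
have size_prefix k : size (prefix k) = k.
  by elim: k => //= k ih; rewrite size_rcons ih.
have good_prefix k : good (prefix k).
  elim: k => [n|k ih]; first by have [A] := unbounded n; exists A.
  by rewrite /=; case: asboolP => //; exact: good_rcons.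
have prefixE m : prefix m = mkseq (fun i => last false (prefix i.+1)) m.
  by elim: m => // m ih; rewrite mkseqS -ih /= last_rcons.
exists (fun i => last false (prefix i.+1)) => m.
have [A [mA PA As]] := good_prefix m m; exists A; split => // i im.
move: As; rewrite size_prefix {1}prefixE => /(congr1 (nth false ^~ i)).
by rewrite !nth_mkseq.
Qed.

Lemma exists_slices : exists (B C D : word) (A : nat -> {fset nat}),
  [/\ forall m, exists2 d, m < d & D d,
      forall b, D b -> P (slice B C D b),
      forall b, D b -> b < #|` A b|%fset &
      forall b, D b -> slice B C D b = (fun c => c \in A b)].
Proof.
have [B /choice[A AP]] := exists_limit.
(* Chosen beyond [b] and all of [A b]: iterating it from 0 enumerates D, and [A (e k)] ends before
   [e k.+1]. Hence the intervals on which C copies the sets [A (e k)] are disjoint. *)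
pose next b := (maxn b (\max_(i <- enum_fset (A b)) i)).+1.
have ltn_next b : b < next b by rewrite ltnS leq_maxl.
have A_next b c : c \in A b -> c < next b.
  move=> cA; rewrite ltnS leq_max; apply/orP; right.
  exact: (@leq_bigmax_seq _ (enum_fset (A b)) xpredT id).
pose e k := iter k next 0.
have e_lt i j : i < j -> e i < e j.
  elim: j => // j ih; rewrite ltnS leq_eqVlt => /predU1P[->|/ih ij].
    exact: ltn_next.
  exact: ltn_trans ij (ltn_next _).
have leq_e k : k <= e k.
  by elim: k => // k ih; exact: leq_ltn_trans ih (ltn_next _).
have e_next i j : e i < e j -> e i.+1 <= e j.
  case: (ltngtP i.+1 j) => [/e_lt/ltnW//|ji|->//].
  by rewrite ltnS in ji; have := ji; rewrite leq_eqVlt => /predU1P[->|/e_lt];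
    rewrite ?ltnn // => h1 h2; have := ltn_trans h1 h2; rewrite ltnn.
pose D : word := fun d => `[< exists k, d = e k >].
pose C : word := fun c => `[< exists k, [/\ e k <= c, c < e k.+1 & c \in A (e k)] >].
have De b : D b -> exists k, b = e k by move=> /asboolP.
have sliceE b : D b -> slice B C D b = (fun c => c \in A b).
  move=> /De[k ->]; apply/funext => c; rewrite /slice; case: ltnP => [ck|kc].
    by have [_ _ ->] := AP (e k).
  (* Membership in C may come from the interval of another index [j]: if [j < k], that interval ends
     by [e k]; if [j > k], then [e j] is an element of D after [e k] but not above [c]. *)
  apply/andP/idP => [[/asboolP[j [jc cj cA]] /asboolP cD]|cA].
    case: (ltngtP j k) => [jk|kj|<-//].
      have := e_next j k (e_lt _ _ jk); lia.
    have /cD/(_ (e_lt _ _ kj)) : D (e j) by apply/asboolP; exists j.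
    by rewrite ltnNge jc.
  have ck := A_next _ _ cA; split; apply/asboolP; first by exists k.
  by move=> d /De[j ->] /e_next; exact: leq_trans.
exists B, C, D, A; split => //.
- move=> m; exists (e m.+1); first exact: leq_e.
  by apply/asboolP; exists m.+1.
- by move=> b Db; rewrite sliceE//; have [] := AP b.
- by move=> b _; have [] := AP b.
Qed.

End compactness.

(** * Equivalence with the quantifier U, and correctness of the translation *)

Lemma slice_finite (B C D : word) b : (forall m, exists2 d, m < d & D d) ->
  exists A : {fset nat}, slice B C D b = (fun c => c \in A).
Proof.
(* Any element [d] of D beyond [b] bounds the whole slice. *)
move=> /(_ b)[d bd Dd]; exists [fset c in iota 0 d | slice B C D b c]%fset.
apply/funext => c; rewrite !inE mem_iota /= add0n.
case: (ltnP c d) => //= dc; apply/negbTE; rewrite /slice ltnNge.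
rewrite (leq_trans (ltnW bd) dc) /= negb_and; apply/orP; right.
by apply/negP => /asboolP /(_ d Dd bd); rewrite ltnNge dc.
Qed.

Lemma unbounded_iff_slices (R : realType) (P : word -> Prop) :
  (forall n, exists2 A : {fset nat}, n < #|` A|%fset & P (fun k => k \in A)) <->
  exists B C D : word,
    [/\ forall m, exists2 d, m < d & D d,
        forall b, D b -> P (slice B C D b) &
        \forall W \ae coin R, exists z, forall b, D b -> z < b ->
          exists2 c, slice B C D b c & ~~ W c].
Proof.
split=> [/exists_slices[B [C [D [A [Dinf DP DA sliceE]]]]]|].
  exists B, C, D; split => //.
  rewrite (@eq_ae _ _ (fun W => exists z, forall b, D b -> z < b ->
    exists2 c, c \in A b & ~~ W c)); first exact: ae_not_superset.
  move=> W; congr (exists _, _); apply/funext => z; apply: eq_forall => b.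
  by apply/propext; split => h Db; move: (h Db); rewrite sliceE.
(* Were [n] a bound on the sizes of satisfying finite sets, all slices would have at most [n]
   elements, and infinitely many would be included in W with positive probability. *)
move=> [B [C [D [Dinf DP Dae]]]] n; apply: contrapT => nP.
have /choice[A AE] b := slice_finite B C b Dinf.
apply: (@not_ae_not_superset R D A n Dinf).
  move=> b Db; rewrite leqNgt; apply/negP => nA; apply: nP.
  by exists (A b) => //; rewrite -AE; exact: DP.
rewrite (@eq_ae _ _ (fun W => exists z, forall b, D b -> z < b ->
    exists2 c, slice B C D b c & ~~ W c))// => W.
congr (exists _, _); apply/funext => z; apply: eq_forall => b.
by rewrite AE.
Qed.

Lemma sat_translate (R : realType) v V phi :
  sat R v V (translate phi) = sat R v V phi.
Proof.
elim: phi v V => [x y|x X|f ih|f ihf g ihg|x f ih|X f ih|X f ih|X f ih] v V //=.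
- by rewrite ih.
- by rewrite ihf ihg.
- by apply: eq_forall => k.
- by apply: eq_forall => k.
(* The three side conditions are freshness: the code of [Unb X f] bounds [X] and the free variables
   of [f], hence those of [translate f]. *)
- rewrite [LHS]sat_unb_almost.
  + rewrite -(propext (unbounded_iff_slices R
      (fun W => sat R v [eta V with X |-> W] (translate f)))).
    by apply: eq_forall => n; congr (exists2 _, _ & _); apply/funext => A.
  + by have := leq_cpair X (goedel f); have := leq_cpair 6 <| X, goedel f |>; lia.
  + move=> x /free_fo_translate xf.
    by apply: (@leq_goedel_free (Unb X f)); rewrite /= xf.
  + move=> Y /free_so_translate Yf.
    have /leq_goedel_free : (Y \in free_fo f) || (Y \in free_so f) by rewrite Yf orbT.
    have := leq_cpair X (goedel f); have := leq_cpair 6 <| X, goedel f |>; lia.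
- exact: eq_ae.
Qed.

Theorem theorem5p1 :
  exists T : formula -> formula,
    effective T /\
    forall (R : realType) (n : nat) (Y : n.-tuple nat) (phi : formula),
      uniq Y ->
      in_S1S_U phi ->
      free_fo phi = [::] ->
      {subset free_so phi <= Y} ->
      [/\ in_S1S_Almost (T phi),
          free_fo (T phi) = [::],
          {subset free_so (T phi) <= Y} &
          language R Y phi = language R Y (T phi)].
Proof.
exists translate; split; first exact: effective_translate.
move=> R n Y phi _ _ fo so; split.
- exact: in_S1S_Almost_translate.
- apply/eqP; rewrite -size_eq0 -leqn0 leqNgt -has_predT; apply/hasP => -[x].
  by move=> /free_fo_translate; rewrite fo.
- by move=> x /free_so_translate /so.
- by apply/seteqP; split => w; rewrite /language /= sat_translate.
Qed.
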